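(* There is an absolute constant $c_1>0$ with the following property. Let $N,Q\ge 1$ be real, let $0\le M\le Q$, let $(a_n)$ be a sequence of complex numbers, and put $$S(\alpha):=\sum_{n\le N}a_n e(n\alpha),\qquad Z:=\sum_{n\le N}|a_n|^2,$$ where $e(x)=e^{2\pi i x}$. Let ${\cal S}\subset (M,M+Q]$ be a set of positive integers. For $t\in\mathbb{N}$ let ${\cal S}_t:=\{q\in\mathbb{N}: tq\in{\cal S}\}$, and for real $u\ge 0$, $k\in\mathbb{N}$, $l\in\mathbb{Z}$ with $\gcd(k,l)=1$ let $$A_t(u,k,l):=\max_{M/t\le y\le (M+Q)/t}\left|\{q\in{\cal S}_t\cap(y,y+u]:\ q\equiv l \bmod k\}\right|.$$ Then $$\sum_{q\in{\cal S}}\ \sum_{\substack{a=1\\ \gcd(a,q)=1}}^{q}\left|S\!\left(\frac aq\right)\right|^2\le c_1 NZ\left(1+\max_{\substack{r\in\mathbb{N}\\ r\le\sqrt N}}\ \max_{1/N\le z\le 1/(r\sqrt N)}\ \max_{\substack{h\in\mathbb{Z}\\ \gcd(h,r)=1}}\ \sum_{t\mid r}\ \sum_{\substack{m\in\mathbb{Z},\ 0<|m|\le 6rzQ/t\\ \gcd(m,r/t)=1}} A_t\!\left(\frac{2Q}{tzN},\frac rt,hm\right)\right).$$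
   Context: $e(x)=e^{2\pi i x}$. Note that in the sum the arguments satisfy $\gcd(r/t,hm)=1$, so $A_t$ is evaluated only where it is defined. *)

(* Defs.v *)
From HB Require Import structures.
From mathcomp Require Import all_boot all_order all_algebra.
From mathcomp Require Import all_classical all_reals all_analysis.
From mathcomp Require Import finmap complex.
Set Implicit Arguments.
Unset Strict Implicit.
Unset Printing Implicit Defensive.
Import Order.TTheory GRing.Theory Num.Theory.
Import numFieldNormedType.Exports.
Local Open Scope classical_set_scope.
Local Open Scope ring_scope.
Local Open Scope complex_scope.

Definition expi2pi {R : realType} (x : R) : R[i] :=
  cos (2 * pi * x) +i* sin (2 * pi * x).

(* The norm `|z| of R[i] is itself R[i]-valued; normc is the R-valued modulus. *)
Definition abs2 {R : realType} (z : R[i]) : R := ComplexField.Normc.normc z ^+ 2.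

(* Sequences are indexed by n >= 1; the value a 0 is never used. *)
Definition trigsum {R : realType} (N : R) (a : nat -> R[i]) (alpha : R) : R[i] :=
  \sum_(1 <= n < (Num.truncn N).+1) a n * expi2pi (n%:R * alpha).

Definition energy {R : realType} (N : R) (a : nat -> R[i]) : R :=
  \sum_(1 <= n < (Num.truncn N).+1) abs2 (a n).

(* A maximum, written as a supremum: it is only used for D nonempty and f
   bounded on D with natural values, and is then attained by
   maxover_attained. *)
Definition maxover {R : realType} {T : Type} (D : set T) (f : T -> R) : R :=
  sup (f @` D).

Lemma maxover_attained (R : realType) (T : Type) (D : set T) (f : T -> R) (B : R) :
  D !=set0 -> (forall x, D x -> f x \is a Num.nat) ->
  (forall x, D x -> f x <= B) ->
  exists2 x, D x & maxover D f = f x.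
Proof.
move=> [x0 Dx0] fnat fB.
have hs : has_sup (f @` D).
  by split; [exists (f x0), x0 | exists B => _ [x Dx <-]; exact: fB].
have [_ [x Dx <-] ltx] := sup_adherent (@ltr01 R) hs.
exists x => //; apply/eqP; rewrite eq_le; apply/andP; split; last first.
  by apply: ub_le_sup; [exact: hs.2 | exists x].
apply: ge_sup; first exact: hs.1.
move=> _ [y Dy <-].
have : f y < f x + 1.
  rewrite -ltrBlDr; apply: le_lt_trans ltx.
  by rewrite lerD2r; apply: ub_le_sup; [exact: hs.2 | exists y].
have /natrP[j ->] := fnat _ Dy; have /natrP[i ->] := fnat _ Dx.
by rewrite natr1 ltr_nat ltnS ler_nat.
Qed.

Definition dilate (S : set nat) (t : nat) : set nat :=
  [set q | (0 < q)%N /\ S (t * q)%N].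

Definition progset {R : realType} (S : set nat) (t : nat) (y u : R)
    (k : nat) (l : int) : set nat :=
  [set q : nat | [/\ dilate S t q, y < q%:R <= y + u
                  & (q%:Z = l %[mod k%:Z])%Z]].

(* This is A_t(u, k, l); the window (y, y + u] starts in [M/t, (M + Q)/t] but
   may extend beyond it. *)
Definition maxcount {R : realType} (M Q : R) (S : set nat) (t : nat) (u : R)
    (k : nat) (l : int) : R :=
  maxover [set y : R | M / t%:R <= y <= (M + Q) / t%:R]
          (fun y => #|` fset_set (progset S t y u k l)|%:R).

Definition divsum {R : realType} (N M Q : R) (S : set nat)
    (r : nat) (z : R) (h : int) : R :=
  \sum_(t <- divisors r)
    \sum_(m \in [set m : int |
             [/\ 0 < `|m|, `|m|%:~R <= 6 * r%:R * z * Q / t%:R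
               & coprimez m (r %/ t)%N%:Z]])
      maxcount M Q S t (2 * Q / (t%:R * z * N)) (r %/ t)%N (h * m).

(* Main.v *)
(**
By duality (the Cauchy-Schwarz step is done as an AM-GM inequality), the large
sieve reduces to bounding the quadratic form with coefficients
|D(alpha_k - alpha_l)|^2, D(x) = sum_(j < 2n) e(jx), n = floor(N).  As
|D(x)|^2 <= min(4 n^2, ||x||^-2), splitting the circle into n cells gives
  sum_k |S(alpha_k)|^2 <= 16 K N Z,
where K bounds the number of alpha_k at distance at most 1/N from any given x.

To bound K for the points a/q, approximate x = b/r + z0 by Dirichlet's theorem
with r <= sqrt N and |z0| <= 1/(r sqrt N), and put z = max(|z0|, 1/N).  A
fraction a/q close to x is determined by q and m = a r - b q.  If m = 0 then
q = r, which accounts for a single fraction.  Otherwise let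
t = gcd(q, r) = gcd(m, r) and m = t m'.  Then q/t is congruent to h m' modulo
r/t, where h b = -1 modulo r, and q/t lies at distance at most 4Q/(tzN) from
+-m'/(rz).  Five windows of length 2Q/(tzN) cover that range, whence
K <= 1 + 5 * (the maximum in the theorem).
*)
Require Import Defs.
From mathcomp Require Import all_boot all_order all_algebra.
From mathcomp Require Import all_classical all_reals all_analysis.
From mathcomp Require Import finmap complex ring lra zify.
Set Implicit Arguments.
Unset Strict Implicit.
Unset Printing Implicit Defensive.
Import Order.TTheory GRing.Theory Num.Theory.
Import numFieldNormedType.Exports.
Local Open Scope classical_set_scope.
Local Open Scope ring_scope.
Local Open Scope complex_scope.

(** * The additive characters *)

Section complex_exponential.
Variable R : realType.
Implicit Types (x y : R) (z w : R[i]).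

Lemma abs2E z : abs2 z = complex.Re z ^+ 2 + complex.Im z ^+ 2.
Proof. by case: z => x y; rewrite /abs2 /= sqr_sqrtr // addr_ge0 ?sqr_ge0. Qed.

Lemma abs2_ge0 z : 0 <= abs2 z.
Proof. by rewrite abs2E addr_ge0 ?sqr_ge0. Qed.

Lemma abs2CJ z : (abs2 z)%:C = z * conjc z.
Proof. by rewrite abs2E; case: z => x y; simpc; congr (_ +i* _); ring. Qed.

Lemma abs2M z w : abs2 (z * w) = abs2 z * abs2 w.
Proof. by rewrite !abs2E; case: z w => x y [u v]; simpc => /=; ring. Qed.

Lemma abs2J z : abs2 (conjc z) = abs2 z.
Proof. by rewrite !abs2E; case: z => x y /=; ring. Qed.

Lemma abs2_1Bl z : abs2 z = 1 -> abs2 (1 - z) <= 4.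
Proof.
rewrite !abs2E; case: z => x y /= h; rewrite sub0r sqrrN.
have : 0 <= y ^+ 2 by exact: sqr_ge0.
by nra.
Qed.

Lemma Re_mulcJ_le z w : complex.Re (z * conjc w) <= (abs2 z + abs2 w) / 2.
Proof.
rewrite !abs2E; case: z w => x y [u v]; simpc => /=.
have := sqr_ge0 (x - u); have := sqr_ge0 (y - v); nra.
Qed.

(** Weighted AM-GM: the difference of the two sides is k/2 times |z - conj(w)/k|^2. *)
Lemma Re_mul_le (k : R) z w : 0 < k ->
  complex.Re (z * w) <= (k * abs2 z + k^-1 * abs2 w) / 2.
Proof.
move=> k0; rewrite !abs2E; case: z w => x y [u v]; simpc => /=.
rewrite -subr_ge0.
have -> : (k * (x ^+ 2 + y ^+ 2) + k^-1 * (u ^+ 2 + v ^+ 2)) / 2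
    - (x * u - y * v) = k / 2 * ((x - u / k) ^+ 2 + (y + v / k) ^+ 2) by field; rewrite gt_eqF.
by rewrite mulr_ge0 ?addr_ge0 ?sqr_ge0 // divr_ge0 // ltW.
Qed.

Lemma Re_mulC (k : R) z : complex.Re (z * k%:C) = complex.Re z * k.
Proof. by case: z => x y; simpc => /=. Qed.

Lemma expi2piD x y : expi2pi (x + y) = expi2pi x * expi2pi y.
Proof.
rewrite /expi2pi mulrDr cosD sinD; simpc; congr (_ +i* _); ring.
Qed.

Lemma expi2piJ x : conjc (expi2pi x) = expi2pi (- x).
Proof. by rewrite /expi2pi /= mulrN cosN sinN. Qed.

Lemma expi2pi0 : expi2pi (0 : R) = 1.
Proof. by rewrite /expi2pi mulr0 cos0 sin0. Qed.

Lemma abs2_expi2pi x : abs2 (expi2pi x) = 1.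
Proof. by rewrite abs2E /= cos2Dsin2. Qed.

Lemma expi2pi_nat (n : nat) : expi2pi (n%:R : R) = 1.
Proof.
elim: n => [|n ih]; first exact: expi2pi0.
rewrite -natr1 expi2piD ih mul1r /expi2pi mulr1.
by rewrite mulr_natl cos2pi sin2pi.
Qed.

Lemma expi2pi_int (k : int) : expi2pi (k%:~R : R) = 1.
Proof.
case: k => n; first exact: expi2pi_nat.
by rewrite NegzE mulrNz -expi2piJ expi2pi_nat conjc1.
Qed.

Lemma expi2piDz x (k : int) : expi2pi (x + k%:~R) = expi2pi x.
Proof. by rewrite expi2piD expi2pi_int mulr1. Qed.

Lemma expi2piX x (n : nat) : expi2pi (n%:R * x) = expi2pi x ^+ n.
Proof.
elim: n => [|n ih]; first by rewrite mul0r expi2pi0 expr0.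
by rewrite -natr1 mulrDl mul1r expi2piD ih exprSr.
Qed.

(** By the mean value theorem sin x = x cos c with 0 < c < x, and cos decreases on [0, pi]. *)
Lemma mulr_cos_le_sin x : 0 <= x <= pi -> x * cos x <= sin x.
Proof.
move=> /andP[]; rewrite le_eqVlt => /predU1P[<-|x0] xpi.
  by rewrite mul0r sin0.
have dsin y : y \in `]0, x[ -> is_derive y 1 (@sin R) (cos y).
  by move=> _; exact: is_derive_sin.
have csin : {within `[0, x], continuous (@sin R)}.
  by apply: continuous_subspaceT; exact: continuous_sin.
have [c] := MVT x0 dsin csin.
rewrite in_itv /= => /andP[c0 cx]; rewrite sin0 !subr0 => ->.
rewrite mulrC ler_wpM2r ?(ltW x0) // ltW // ltr_cos //; rewrite in_itv /=.
- by apply/andP; split; lra.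
- by apply/andP; split; lra.
Qed.

(* Half-angle: sin x = 2 sin (x/2) cos (x/2) >= x cos^2 (x/2) >= x/2. *)
Lemma half_le_sin x : 0 <= x <= pi / 2 -> x / 2 <= sin x.
Proof.
move=> /andP[x0 xpi]; have pi0 := @pi_gt0 R.
have E : x = (x / 2) *+ 2 by rewrite -mulr_natl; field.
have s : sin x = 2 * (cos (x / 2) * sin (x / 2)).
  by rewrite mulr_natl -sin_mulr2n -E.
have c : cos x = 2 * cos (x / 2) ^+ 2 - 1.
  by rewrite mulr_natl -cos_mulr2n -E.
have cx : 0 <= cos x by apply: cos_ge0_pihalf; apply/andP; split; lra.
have ch : 0 <= cos (x / 2) by apply: cos_ge0_pihalf; apply/andP; split; lra.
have : x / 2 * cos (x / 2) <= sin (x / 2).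
  by apply: mulr_cos_le_sin; apply/andP; split; lra.
move: ch cx; rewrite s c; move: (cos _) (sin _) => C T C0 Cx h.
have := mulr_ge0 x0 Cx; have := ler_wpM2l C0 h; lra.
Qed.

(** |1 - e(x)| = 2 |sin(pi x)|, and sin(pi x) >= pi x / 2 >= x because pi >= 2. *)
Lemma abs2_1Bexp_ge x : 0 <= x <= 1 / 2 -> 4 * x ^+ 2 <= abs2 (1 - expi2pi x).
Proof.
move=> /andP[x0 x1]; have pi2 := @pi_ge2 R.
have -> : abs2 (1 - expi2pi x) = 4 * sin (pi * x) ^+ 2.
  rewrite /expi2pi.
  have -> : 2 * pi * x = (pi * x) *+ 2 by rewrite -mulrA mulr_natl.
  rewrite abs2E /= sub0r sqrrN cos_mulr2n sin_mulr2n cos2sin2.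
  have -> : (cos (pi * x) * sin (pi * x) *+ 2) ^+ 2
      = 4 * (cos (pi * x) ^+ 2 * sin (pi * x) ^+ 2) by ring.
  by rewrite cos2sin2; ring.
have h : x <= sin (pi * x).
  apply: (@le_trans _ _ (pi * x / 2)).
    by have := ler_wpM2r x0 pi2; lra.
  apply: half_le_sin; apply/andP; split; first by rewrite mulr_ge0 // pi_ge0.
  by rewrite ler_wpM2l ?pi_ge0 //; lra.
by rewrite ler_pM2l // lerXn2r // nnegrE // (le_trans x0).
Qed.

End complex_exponential.

(** * The large sieve for points with multiplicity *)

Section dirichlet_kernel.
Variable R : realType.
Local Notation normc := ComplexField.Normc.normc.
Implicit Types (x y : R) (z w : R[i]).

(** The kernel D of the overview is the case [H] = 2n. *)
Definition expsum (H : nat) (x : R) : R[i] := \sum_(j < H) expi2pi (j%:R * x).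

Lemma expsumDz H x (k : int) : expsum H (x + k%:~R) = expsum H x.
Proof.
apply: eq_bigr => j _.
rewrite mulrDr -[X in X * k%:~R](mulrz_nat) -intrM expi2piDz //.
Qed.

Lemma expsum_mul1B H x :
  expsum H x * (1 - expi2pi x) = 1 - expi2pi (H%:R * x).
Proof.
rewrite expi2piX -[RHS]opprB subrX1 -mulNr opprB mulrC; congr (_ * _).
by apply: eq_bigr => j _; rewrite expi2piX.
Qed.

Lemma abs2_expsum_le H x : abs2 (expsum H x) <= H%:R ^+ 2.
Proof.
have n1 y : normc (expi2pi y) = 1 by rewrite /= cos2Dsin2 sqrtr1.
suff h : normc (expsum H x) <= H%:R.
  rewrite /abs2 lerXn2r ?nnegrE ?ler0n //.
  by case: (expsum H x) => u v /=; exact: sqrtr_ge0.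
elim: H => [|H ih]; first by rewrite /expsum big_ord0 /= expr0n addr0 sqrtr0.
rewrite /expsum big_ord_recr /= (le_trans (le_normcD _ _)) // n1 -natr1.
by rewrite lerD2r.
Qed.

(* D(x) (1 - e(x)) = 1 - e(2nx) gives |D(x)| <= 1/||x||; the two summands serve
   x mod 1 in [0, 1/2] and in [1/2, 1]. *)
Lemma abs2_expsum_frac_le (n j : nat) x (k : int) : (j < n)%N ->
  j%:R <= n%:R * (x - k%:~R) < j.+1%:R ->
  abs2 (expsum (2 * n) x) <=
    4 * n%:R ^+ 2 * ((j.+1%:R ^- 2) + ((n - j)%:R ^- 2)).
Proof.
move=> jn; set b := x - k%:~R => /andP[jb bj].
have n0 : 0 < n%:R :> R by rewrite ltr0n (leq_ltn_trans _ jn).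
have -> : expsum (2 * n) x = expsum (2 * n) b.
  by rewrite -[in LHS](subrK k%:~R x) expsumDz.
have b0 : 0 <= b by rewrite -(pmulr_rge0 _ n0) (le_trans _ jb).
have b1 : b <= 1.
  rewrite -(ler_pM2l n0) mulr1 (le_trans (ltW bj)) // ler_nat //.
have trivial_bound : abs2 (expsum (2 * n) b) <= 4 * n%:R ^+ 2.
  by rewrite (le_trans (abs2_expsum_le _ _)) // natrM exprMn; lra.
have prod_bound : abs2 (expsum (2 * n) b) * abs2 (1 - expi2pi b) <= 4.
  by rewrite -abs2M expsum_mul1B abs2_1Bl // abs2_expi2pi.
(* Here [d] will be the distance from [b] to 0 or to 1. By [prod_bound] and [abs2_1Bexp_ge], |D|^2
   d^2 <= 1. For i >= 1 use i + 1 <= 2i <= 2nd; for i = 0 the trivial bound suffices. *)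
have dist_bound (i : nat) (d : R) : 0 <= d <= 1 / 2 -> i%:R <= n%:R * d ->
    abs2 (1 - expi2pi b) = abs2 (1 - expi2pi d) ->
    abs2 (expsum (2 * n) b) <= 4 * n%:R ^+ 2 * i.+1%:R ^- 2.
  move=> d01 id ebd; rewrite ler_pdivlMr ?exprn_gt0 ?ltr0n //.
  have [->|i0] := posnP i; first by rewrite expr1n mulr1.
  have i1 : 1 <= i%:R :> R by rewrite ler1n.
  move: prod_bound; rewrite ebd.
  have := abs2_1Bexp_ge d01; move: (abs2 (1 - _)) => B hB.
  have := abs2_ge0 (expsum (2 * n) b); move: (abs2 _) => A A0 hAB.
  have h1 : A * d ^+ 2 <= 1.
    have := ler_wpM2l A0 hB; lra.
  have h2 : i.+1%:R ^+ 2 <= (2 * (n%:R * d)) ^+ 2 :> R.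
    rewrite lerXn2r ?nnegrE ?ler0n //; first by lra.
    by rewrite -natr1; lra.
  apply: (le_trans (ler_wpM2l A0 h2)).
  have -> : A * (2 * (n%:R * d)) ^+ 2 = 4 * n%:R ^+ 2 * (A * d ^+ 2) by ring.
  rewrite -[leRHS]mulr1 ler_wpM2l // mulr_ge0 ?sqr_ge0 //.
have [bh|bh] := leP b (1 / 2).
- have b01 : 0 <= b <= 1 / 2 by rewrite b0.
  apply: (le_trans (dist_bound j b b01 jb erefl)).
  rewrite ler_pM2l ?mulr_gt0 ?exprn_gt0 // lerDl invr_ge0.
  by rewrite exprn_ge0.
- have b01 : 0 <= 1 - b <= 1 / 2 by apply/andP; split; lra.
  (* Seen from the endpoint 1 the cell has index n - j - 1, since n(1 - b) > n - (j + 1). *)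
  apply: (le_trans (dist_bound (n - j.+1)%N (1 - b) b01 _ _)).
  + rewrite natrB // mulrBr mulr1; lra.
  + have -> : expi2pi (1 - b) = conjc (expi2pi b).
      by rewrite expi2piJ addrC -[X in _ + X]/(1%:~R) expi2piDz.
    by rewrite -[in RHS]conjc1 -rmorphB abs2J.
  rewrite -subSn // subSS ler_pM2l ?mulr_gt0 ?exprn_gt0 // lerDr invr_ge0.
  by rewrite exprn_ge0.
Qed.
End dirichlet_kernel.

(** * Duality and the large sieve inequality *)

Section large_sieve.
Variable R : realType.
Implicit Types (x y : R) (z w : R[i]).

(** The induction proves the stronger bound 2 - 1/n for n >= 1, by 1/(y+1)^2 <= 1/y - 1/(y+1). *)
Lemma sum_inv_sqr_le (n : nat) : \sum_(j < n) (j.+1%:R ^- 2 : R) <= 2.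
Proof.
case: n => [|n]; first by rewrite big_ord0.
suff : \sum_(j < n.+1) (j.+1%:R ^- 2 : R) <= 2 - n.+1%:R^-1.
  by move=> /le_trans; apply; rewrite gerBl invr_ge0.
elim: n => [|n ih]; first by rewrite big_ord1 expr1n invr1; lra.
rewrite big_ord_recr /=; move: ih; move: (\sum_(_ < _) _) => s ih.
have n0 : 0 < n.+1%:R :> R by rewrite ltr0n.
rewrite -(natr1 n.+1); move: ih n0; move: (n.+1%:R : R) => y ih y0.
suff : (y + 1) ^- 2 <= y^-1 - (y + 1)^-1 by lra.
have -> : y^-1 - (y + 1)^-1 = (y * (y + 1))^-1 by field; apply/andP; split; lra.
rewrite lef_pV2 ?posrE ?exprn_gt0 ?mulr_gt0 //; first nra; lra.
Qed.

Lemma sum_inv_sqr_rev_le (n : nat) : \sum_(j < n) ((n - j)%:R ^- 2 : R) <= 2.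
Proof.
rewrite (reindex_inj rev_ord_inj) /=.
under eq_bigr => j _ do rewrite subKn //.
exact: sum_inv_sqr_le.
Qed.

Section spaced_points.
Variables (T : Type) (s : seq T) (al : T -> R) (n : nat) (K : R).
Hypothesis n0 : (0 < n)%N.
Hypothesis countK : forall x,
  (count (fun t => `[< exists k : int, `|al t - x - k%:~R| <= (2 * n%:R)^-1 >])
    s)%:R <= K.

(** A point in cell j, measured from x, contributes at most [w j]; each of the n cells holds at most
    [K] points, and the weights sum to at most 16 n^2. *)
Lemma sum_abs2_expsum_le x :
  \sum_(t <- s) abs2 (expsum (2 * n) (x - al t)) <= 16 * n%:R ^+ 2 * K.
Proof.
have nR : 0 < n%:R :> R by rewrite ltr0n.
pose cell (j : nat) t := `[< exists k : int,
  j%:R <= n%:R * (x - al t - k%:~R) < j.+1%:R >].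
pose w (j : nat) : R := 4 * n%:R ^+ 2 * ((j.+1%:R ^- 2) + ((n - j)%:R ^- 2)).
have w0 j : 0 <= w j.
  by rewrite /w mulr_ge0 ?mulr_ge0 ?sqr_ge0 // addr_ge0 // invr_ge0 exprn_ge0.
have K0 : 0 <= K by rewrite (le_trans _ (countK 0)).
apply: (@le_trans _ _
  (\sum_(t <- s) \sum_(j < n) (if cell j t then w j else 0))).
  apply: ler_sum => t _; set k := Num.floor (x - al t).
  set y := n%:R * (x - al t - k%:~R).
  have y0 : 0 <= y by rewrite mulr_ge0 ?(ltW nR) // subr_ge0 floor_le.
  have yn : y < n%:R.
    rewrite -[ltRHS]mulr1 ltr_pM2l // ltrBlDl.
    by rewrite -[1]/(1%:~R) -intrD; exact: floorD1_gt.
  have /andP[jy yj] := truncn_itv y0.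
  have jn : (Num.truncn y < n)%N by rewrite -(ltr_nat R) (le_lt_trans jy).
  rewrite (bigD1 (Ordinal jn)) //= ifT; last by apply/asboolP; exists k; rewrite jy.
  rewrite (le_trans (@abs2_expsum_frac_le _ n _ _ k jn _)) ?jy //.
  by rewrite lerDl sumr_ge0 // => i _; case: ifP.
rewrite exchange_big /=.
apply: (@le_trans _ _ (\sum_(j < n) w j * K)).
  apply: ler_sum => j _; rewrite -big_mkcond /= big_const_seq iter_addr_0 -mulr_natr.
  (* The arc is centred at the midpoint of the cell, whose half-width is 1/(2n). *)
  rewrite ler_wpM2l //; apply: le_trans (countK (x - (j%:R + 1 / 2) / n%:R)).
  rewrite ler_nat; apply: sub_count => t /asboolP[k /andP[h1 h2]].
  apply/asboolP; exists (- k); rewrite mulrNz opprK.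
  rewrite -(ler_pM2l nR) -{1}(gtr0_norm nR) -normrM.
  have -> : n%:R * (2 * n%:R)^-1 = 1 / 2 :> R by field; rewrite gt_eqF.
  have -> : n%:R * (al t - (x - (j%:R + 1 / 2) / n%:R) + k%:~R) =
    j%:R + 1 / 2 - n%:R * (x - al t - k%:~R) by field; rewrite gt_eqF.
  by rewrite -natr1 in h2; rewrite ler_norml; apply/andP; split; lra.
rewrite -mulr_suml ler_wpM2r // /w -mulr_sumr big_split /=.
have := sum_inv_sqr_le n; have := sum_inv_sqr_rev_le n.
have : 0 <= n%:R ^+ 2 :> R by exact: sqr_ge0.
nra.
Qed.

Lemma abs2_expsumN H x : abs2 (expsum H (- x)) = abs2 (expsum H x).
Proof.
rewrite -[RHS]abs2J; congr abs2; rewrite /expsum rmorph_sum.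
by apply: eq_bigr => j _; rewrite mulrN -expi2piJ.
Qed.

Lemma Re_sum (I : Type) (r : seq I) (F : I -> R[i]) :
  complex.Re (\sum_(i <- r) F i) = \sum_(i <- r) complex.Re (F i).
Proof. by apply: (big_morph (@complex.Re R)) => // -[a b] [c d]. Qed.

Variable c : T -> R[i].

(** The transpose of the map from [a] to its values at the points [al t]. The frequency is real so
    that negative differences i - j can be inserted. *)
Definition dualsum x : R[i] := \sum_(t <- s) c t * expi2pi (x * al t).

(** Expand the square: the sum over i and j of e((i - j)(al t - al u)) factors as D times its
    conjugate. *)
Lemma sum_abs2_dualsumB H :
  \sum_(i < H) \sum_(j < H) abs2 (dualsum (i%:R - j%:R)) =
  \sum_(t <- s) \sum_(u <- s)
     complex.Re (c t * conjc (c u)) * abs2 (expsum H (al t - al u)).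
Proof.
under [RHS]eq_bigr => t _.
  under eq_bigr => u _ do rewrite -Re_mulC.
  rewrite -Re_sum.
  over.
rewrite -Re_sum -[LHS]/(complex.Re (_%:C)); congr complex.Re.
rewrite rmorph_sum /=.
under eq_bigr => i _.
  rewrite rmorph_sum /=.
  under eq_bigr => j _.
    rewrite abs2CJ /dualsum rmorph_sum mulr_suml.
    under eq_bigr => t _ do rewrite mulr_sumr.
    over.
  rewrite exchange_big /=; under eq_bigr => t _ do rewrite exchange_big.
  over.
rewrite exchange_big /=; apply: eq_bigr => t _.
rewrite exchange_big /=; apply: eq_bigr => u _.
rewrite abs2CJ {1}/expsum mulr_suml mulr_sumr; apply: eq_bigr => i _.
rewrite /expsum rmorph_sum !mulr_sumr; apply: eq_bigr => j _.
rewrite rmorphM mulrACA; congr (_ * _).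
rewrite -[LHS]/(expi2pi _ * conjc (expi2pi _))
  -[RHS]/(expi2pi _ * conjc (expi2pi _)).
by rewrite !expi2piJ -!expi2piD; congr expi2pi; ring.
Qed.

(** For each of the n values j < n, the indices i = j + 1, ..., j + n stay below 2n and give the
    differences 1, ..., n; all other terms are nonnegative. This is why the kernel has length 2n. *)
Lemma sum_abs2_dualsum_le :
  n%:R * \sum_(1 <= m < n.+1) abs2 (dualsum m%:R) <=
  \sum_(i < 2 * n) \sum_(j < 2 * n) abs2 (dualsum (i%:R - j%:R)).
Proof.
rewrite exchange_big /=.
have pos (i j : nat) : 0 <= abs2 (dualsum (i%:R - j%:R)) by exact: abs2_ge0.
apply: (@le_trans _ _
  (\sum_(j < n) \sum_(i < 2 * n) abs2 (dualsum (i%:R - j%:R)))).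
  rewrite mulr_natl -[X in _ *+ X]card_ord -sumr_const.
  apply: ler_sum => j _.
  rewrite -(big_mkord xpredT (fun i => abs2 (dualsum (i%:R - j%:R)))).
  rewrite (@big_cat_nat _ _ _ j.+1 0%N (2 * n)%N) //=;
    last by have := ltn_ord j; lia.
  rewrite (@big_cat_nat _ _ _ (j + n.+1)%N j.+1 (2 * n)%N) //=;
    [|lia|by have := ltn_ord j; lia].
  rewrite addrA -[leLHS]addr0 lerD ?sumr_ge0 // -[leLHS]add0r lerD ?sumr_ge0 //.
  rewrite (addnC j n.+1) -(add1n j) big_addn addnK.
  by apply: ler_sum => i _; rewrite natrD addrK.
rewrite -(big_mkord xpredT
  (fun j => \sum_(i < 2 * n) abs2 (dualsum (i%:R - j%:R)))).
rewrite -(big_mkord xpredT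
  (fun j => \sum_(i < 2 * n) abs2 (dualsum (i%:R - j%:R)))).
rewrite (@big_cat_nat _ _ _ n 0 (2 * n)%N) //=; last lia.
rewrite lerDl; apply: sumr_ge0 => j _; exact: sumr_ge0.
Qed.

(** AM-GM on c_t conj(c_u) and the evenness of |D|^2 reduce the quadratic form to its row sums, each
    at most 16 n^2 K; one factor n cancels. *)
Lemma dual_large_sieve :
  \sum_(1 <= m < n.+1) abs2 (dualsum m%:R) <=
  16 * n%:R * K * \sum_(t <- s) abs2 (c t).
Proof.
have nR : 0 < n%:R :> R by rewrite ltr0n.
rewrite -(ler_pM2l nR) (le_trans sum_abs2_dualsum_le) // sum_abs2_dualsumB.
apply: (@le_trans _ _ (\sum_(t <- s) \sum_(u <- s)
   (abs2 (c t) + abs2 (c u)) / 2 * abs2 (expsum (2 * n) (al t - al u)))).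
  apply: ler_sum => t _; apply: ler_sum => u _.
  by rewrite ler_wpM2r ?abs2_ge0 ?Re_mulcJ_le.
under eq_bigr => t _.
  under eq_bigr => u _ do rewrite mulrDl mulrDl.
  rewrite big_split /= -mulr_sumr.
  over.
rewrite big_split /= [X in _ + X]exchange_big /=.
under [X in _ + X]eq_bigr => u _.
  under eq_bigr => t _ do rewrite -abs2_expsumN opprB.
  rewrite -mulr_sumr.
  over.
rewrite -big_split /= mulr_sumr mulr_sumr; apply: ler_sum => t _.
have := ler_wpM2l (abs2_ge0 (c t)) (sum_abs2_expsum_le (al t)).
by lra.
Qed.

End spaced_points.

(** Test the dual inequality on c_t = conj(S(al t)): the left side X then pairs [a] with the dual
    sum, whose square sum is at most L X. *)
Theorem large_sieve (T : Type) (s : seq T) (al : T -> R) (N K : R)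
    (a : nat -> R[i]) : 1 <= N -> 0 < K ->
  (forall x, (count (fun t =>
     `[< exists k : int, `|al t - x - k%:~R| <= N^-1 >]) s)%:R <= K) ->
  \sum_(t <- s) abs2 (trigsum N a (al t)) <= 16 * N * K * energy N a.
Proof.
move=> N1 K0 countK; set n := Num.truncn N.
have N0 : 0 <= N by lra.
have n0 : (0 < n)%N by rewrite truncn_gt0.
have nR : 0 < n%:R :> R by rewrite ltr0n.
have nN : n%:R <= N by rewrite truncn_le.
(* This holds as N < n + 1 <= 2n. *)
have Nn : N^-1 >= (2 * n%:R)^-1.
  rewrite lef_pV2 ?posrE ?mulr_gt0 //; last lra.
  have /andP[_] := truncn_itv N0; rewrite -natr1 -/n.
  have : 1 <= n%:R :> R by rewrite ler1n.
  lra.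
pose c t := conjc (trigsum N a (al t)).
have countn x : (count (fun t =>
    `[< exists k : int, `|al t - x - k%:~R| <= (2 * n%:R)^-1 >]) s)%:R <= K.
  apply: le_trans (countK x); rewrite ler_nat; apply: sub_count => t.
  move=> /asboolP[k hk]; apply/asboolP; exists k; exact: le_trans hk Nn.
have := dual_large_sieve n0 countn c.
have -> : \sum_(t <- s) abs2 (c t) = \sum_(t <- s) abs2 (trigsum N a (al t)).
  by apply: eq_bigr => t _; rewrite abs2J.
set X := \sum_(t <- s) _; set L := 16 * n%:R * K => dual.
have L0 : 0 < L by rewrite !mulr_gt0.
have XE : X = \sum_(1 <= m < n.+1) complex.Re (a m * dualsum s al c m%:R).
  rewrite -Re_sum -[LHS]/(complex.Re (_%:C)); congr complex.Re.
  rewrite rmorph_sum /=.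
  under eq_bigr => t _ do rewrite abs2CJ {1}/trigsum mulr_suml.
  rewrite exchange_big /=; apply: eq_bigr => m _.
  rewrite /dualsum mulr_sumr; apply: eq_bigr => t _.
  by rewrite -mulrA; congr (_ * _); rewrite mulrC.
(* With weight L in AM-GM, the dual bound returns exactly X/2, which the left side absorbs. *)
have : X <= (L * energy N a + L^-1 * (L * X)) / 2.
  rewrite {1}XE; apply: (@le_trans _ _ (\sum_(1 <= m < n.+1)
      (L * abs2 (a m) + L^-1 * abs2 (dualsum s al c m%:R)) / 2)).
    by apply: ler_sum => m _; exact: Re_mul_le.
  rewrite -mulr_suml big_split /= -!mulr_sumr.
  rewrite ler_pM2r ?invr_gt0 // lerD2l ler_pM2l ?invr_gt0 //.
rewrite mulKf ?gt_eqF // => h.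
have E0 : 0 <= energy N a by apply: sumr_ge0 => m _; exact: abs2_ge0.
apply: (@le_trans _ _ (L * energy N a)); first by lra.
by rewrite ler_wpM2r // /L ler_pM2r // ler_pM2l.
Qed.

End large_sieve.

(** * Counting fractions near a point *)

Section dirichlet.
Variable R : realType.

(** Pigeonhole with n + 1 fractional parts (i = 0, ..., n) and n + 1 boxes. Either two parts share a
    box, or every box is hit; then the part in the last box has i > 0 and lies within 1/(n + 1) of
    1. *)
Lemma dirichlet_multiple (n : nat) (x : R) : (0 < n)%N ->
  exists r b, (0 < r <= n)%N /\ `|r%:R * x - b%:~R| <= n.+1%:R^-1.
Proof.
move=> n0; have n1 : 0 < n.+1%:R :> R by rewrite ltr0n.
pose fl (i : nat) := Num.floor (i%:R * x).
pose fr (i : nat) := i%:R * x - (fl i)%:~R.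
have fr0 i : 0 <= fr i by rewrite subr_ge0 floor_le.
have fr1 i : fr i < 1.
  by rewrite ltrBlDl -[1]/(1%:~R) -intrD; exact: floorD1_gt.
have box0 i : 0 <= n.+1%:R * fr i by rewrite mulr_ge0.
have box i : (Num.truncn (n.+1%:R * fr i) < n.+1)%N.
  rewrite -(ltr_nat R) (@le_lt_trans _ _ (n.+1%:R * fr i)) //.
    by have /andP[] := truncn_itv (box0 i).
  by rewrite -[ltRHS]mulr1 ltr_pM2l.
pose f (i : 'I_n.+1) := Ordinal (box i).
have [finj|/injectivePn[i [j ij fij]]] := boolP (injectiveb f).
- have [g _ gK] := injF_bij (injectiveP _ finj).
  pose i := g ord_max; have fi : f i = ord_max by rewrite /i gK.
  have hi : n%:R <= n.+1%:R * fr i.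
    have /andP[+ _] := truncn_itv (box0 i).
    by move/(congr1 val): fi => /= ->.
  have i0 : (0 < i)%N.
    rewrite lt0n; apply/eqP => i0; move: hi.
    rewrite /fr /fl i0 mul0r floor0 subr0 mulr0 leNgt ltr0n n0 //.
  exists i, (fl i + 1); split; first by rewrite i0 -ltnS ltn_ord.
  rewrite intrD opprD addrA -/(fr i) distrC ger0_norm ?subr_ge0 ?(ltW (fr1 i)) //.
  rewrite -(ler_pM2l n1) mulfV ?gt_eqF // mulrBr mulr1.
  by rewrite -[X in X - _]natr1; lra.
- wlog ltij : i j ij fij / (i < j)%N.
    move=> H; have [|ji|/val_inj eij] := ltngtP i j; first exact: H.
      by apply: (H j i) => //; rewrite eq_sym.
    by rewrite eij eqxx in ij.
  exists (j - i)%N, (fl j - fl i); split.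
    by have := ltn_ord j; lia.
  have -> : (j - i)%:R * x - (fl j - fl i)%:~R = fr j - fr i.
    by rewrite natrB 1?ltnW // intrB /fr; ring.
  have /andP[h1 h2] := truncn_itv (box0 i).
  have /andP[h3 h4] := truncn_itv (box0 j).
  move/(congr1 val): fij => /= fij; rewrite -fij in h3 h4.
  rewrite -(ler_pM2l n1) mulfV ?gt_eqF // -{1}(gtr0_norm n1) -normrM.
  rewrite -(natr1 (Num.truncn _)) in h2; rewrite -(natr1 (Num.truncn _)) in h4.
  by rewrite mulrBr ler_norml; apply/andP; split; lra.
Qed.

(** Take n = floor(X), so 1/(n + 1) < 1/X, and cancel the gcd g: the error is at most 1/(r g X). *)
Lemma dirichlet_coprime (X x : R) : 1 <= X ->
  exists r b, [/\ (0 < r)%N, r%:R <= X, coprimez b r%:Z &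
    `|x - b%:~R / r%:R| <= (r%:R * X)^-1].
Proof.
move=> X1; have X0 : 0 < X by lra.
have n0 : (0 < Num.truncn X)%N by rewrite truncn_gt0.
have /andP[nX Xn] := truncn_itv (ltW X0).
have [r0 [b0 [/andP[r00 r0n] h]]] := dirichlet_multiple x n0.
have {}h : `|r0%:R * x - b0%:~R| <= X^-1.
  by apply: (le_trans h); rewrite lef_pV2 ?posrE // ltW.
pose g := gcdz b0 r0%:Z.
have g0 : (0 < `|g|)%N by rewrite absz_gt0 gcdz_eq0 negb_and orbC eqz_nat -lt0n r00.
have gg : g = `|g|%N%:Z by rewrite /g.
have /dvdzP[b bE] : (g %| b0)%Z by exact: dvdz_gcdl.
have /dvdnP[r rE] : (`|g| %| r0)%N by have : (g %| r0%:Z)%Z by exact: dvdz_gcdr.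
have r_gt0 : (0 < r)%N by move: r00; rewrite rE; lia.
have rR : 0 < r%:R :> R by rewrite ltr0n.
have gR : 1 <= `|g|%N%:R :> R by rewrite ler1n.
exists r, b; split => //.
- apply: le_trans nX; rewrite ler_nat (leq_trans _ r0n) // rE; nia.
- have : gcdz b r%:Z * `|g|%N%:Z = g.
    have e : r%:Z * g = r0 by rewrite gg -PoszM -rE.
    by rewrite mulz_gcdl -bE e.
  rewrite {2}gg /coprimez => e; apply/eqP; nia.
- have -> : x - b%:~R / r%:R = (r0%:R * x - b0%:~R) / (r%:R * `|g|%N%:R).
    rewrite bE rE natrM intrM gg; field; rewrite !gt_eqF //; lra.
  rewrite normrM [X in _ * X]gtr0_norm ?invr_gt0 ?mulr_gt0 //; last lra.
  rewrite ler_pdivrMr ?mulr_gt0 //; last lra.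
  apply: (le_trans h); rewrite invfM.
  have -> : r%:R^-1 * X^-1 * (r%:R * `|g|%N%:R) = X^-1 * `|g|%N%:R.
    by field; rewrite !gt_eqF.
  by rewrite -[leLHS]mulr1 ler_wpM2l // invr_ge0 ltW.
Qed.
End dirichlet.

(** With q = t q' and r = t r', take m = a r' - b q'. Modulo r' one has u b = 1 and m = -b q', so -u
    m = q'. *)
Lemma residue_split (q r : nat) (a b u v : int) :
  (0 < q)%N -> u * b + v * r%:Z = 1 ->
  exists m : int, [/\ a * r%:Z - b * q%:Z = (gcdn q r)%:Z * m,
    coprimez m (r %/ gcdn q r)%N%:Z
    & ((q %/ gcdn q r)%N%:Z = - u * m %[mod (r %/ gcdn q r)%N%:Z])%Z].
Proof.
move=> q0 ub; set t := gcdn q r.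
have t0 : (0 < t)%N by rewrite gcdn_gt0 q0.
have /dvdnP[q' qE] : (t %| q)%N by exact: dvdn_gcdl.
have /dvdnP[r' rE] : (t %| r)%N by exact: dvdn_gcdr.
have [x [y xy]] : exists x y, x * q'%:Z + y * r'%:Z = 1.
  have /coprimezP[[x y] /= xy] : coprimez q'%:Z r'%:Z.
    rewrite coprimezE /= /coprime -(eqn_pmul2r t0) muln_gcdl -qE -rE mul1n //.
  by exists x, y.
exists (a * r'%:Z - b * q'%:Z); split.
- rewrite {1}rE {1}qE !PoszM; ring.
- rewrite {1}rE mulnK //; apply/coprimezP.
  (* Modulo r', u inverts b and x inverts q', so -u x inverts m; the second entry is the resulting
     quotient. *)
  exists (- u * x, u * x * a + v * t%:Z + y - v * t%:Z * r'%:Z * y) => /=.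
  have e1 : u * b = 1 - v * (r'%:Z * t%:Z) by rewrite -ub rE PoszM; ring.
  have e2 : x * q'%:Z = 1 - y * r'%:Z by rewrite -xy; ring.
  transitivity ((u * b) * (x * q'%:Z) +
    (v * t%:Z + y - v * t%:Z * r'%:Z * y) * r'%:Z).
    by ring.
  by rewrite e2 e1; ring.
- rewrite rE qE !mulnK //; apply/eqP; rewrite eqz_mod_dvd.
  apply/dvdzP; exists (v * t%:Z * q'%:Z + u * a).
  have e1 : u * b = 1 - v * (r'%:Z * t%:Z) by rewrite -ub rE PoszM; ring.
  transitivity (q'%:Z - (u * b) * q'%:Z + u * a * r'%:Z); first by ring.
  by rewrite e1; ring.
Qed.

(** This settles the case m = 0. As q divides a r and is prime to a, it divides r, and
    symmetrically. *)
Lemma eq_of_cross_mul (q r : nat) (a b : int) :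
  coprimez a q%:Z -> coprimez b r%:Z -> a * r%:Z = b * q%:Z -> q = r.
Proof.
move=> /coprimezP[[x y] /= xy] /coprimezP[[u v] /= uv] e.
apply/eqP; rewrite eqn_dvd; apply/andP; split.
  suff : (q%:Z %| r%:Z)%Z by [].
  apply/dvdzP; exists (x * b + y * r%:Z).
  have -> : (x * b + y * r%:Z) * q%:Z = x * (b * q%:Z) + y * q%:Z * r%:Z by ring.
  by rewrite -e -[LHS]mul1r -xy; ring.
suff : (r%:Z %| q%:Z)%Z by [].
apply/dvdzP; exists (u * a + v * q%:Z).
have -> : (u * a + v * q%:Z) * r%:Z = u * (a * r%:Z) + v * r%:Z * q%:Z by ring.
by rewrite e -[LHS]mul1r -uv; ring.
Qed.

Lemma card_fset_set_le (T : choiceType) (A : set T) (s : seq T) :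
  A `<=` [set` s] -> finite_set A /\ (#|` fset_set A| <= size s)%N.
Proof.
move=> As; have fA : finite_set A by apply: sub_finite_set As (finite_seq s).
split => //; apply: uniq_leq_size; first exact: fset_uniq.
by move=> x; rewrite in_fset_set // => /set_mem /As.
Qed.

(** * Bounds for the maxima and for counts in progressions *)

Section maxima.
Variable R : realType.

Lemma le_maxover (T : Type) (D : set T) (f : T -> R) (B : R) (x : T) :
  (forall y, D y -> f y <= B) -> D x -> f x <= maxover D f.
Proof.
move=> fB Dx; apply: ub_le_sup; last by exists x.
by exists B => _ [y Dy <-]; exact: fB.
Qed.

Lemma maxover_le (T : Type) (D : set T) (f : T -> R) (B : R) :
  0 <= B -> (forall y, D y -> f y <= B) -> maxover D f <= B.
Proof.
(* The supremum of the empty set is 0 by convention, whence [0 <= B]. *)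
move=> B0 fB; rewrite /maxover; have [->|ne] := eqVneq (f @` D) set0.
  by rewrite sup0.
apply: ge_sup; first exact/set0P.
by move=> _ [y Dy <-]; exact: fB.
Qed.

Lemma int_ball_bound (X : R) :
  [set m : int | `|m|%:~R <= X] `<=`
  [set` [seq i%:Z - (Num.truncn X)%:Z | i <- iota 0 (2 * Num.truncn X).+1]].
Proof.
move=> m hm; suff : m \in [seq i%:Z - (Num.truncn X)%:Z |
  i <- iota 0 (2 * Num.truncn X).+1] by [].
have {}hm : `|m|%:~R <= X := hm.
have X0 : 0 <= X by apply: le_trans hm; rewrite ler0z.
have /andP[_ Xn] := truncn_itv X0.
have : `|m|%:~R < (Num.truncn X).+1%:R :> R by exact: le_lt_trans hm Xn.
rewrite -[ltRHS]/((Num.truncn X).+1%:Z%:~R) ltr_int => {}hm.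
apply/mapP; exists (absz (m + (Num.truncn X)%:Z)); last lia.
rewrite mem_iota; lia.
Qed.

Variables (M Q : R) (S : set nat).
Hypothesis hS : forall q, S q -> (0 < q)%N /\ M < q%:R <= M + Q.

Let W := (Num.truncn (M + Q)).+1.

Lemma moduli_lt q : S q -> (q < W)%N.
Proof.
move=> /hS[q0 /andP[_ qMQ]].
have MQ0 : 0 <= M + Q by rewrite (le_trans _ qMQ).
have /andP[_ h] := truncn_itv MQ0.
by rewrite -(ltr_nat R) (le_lt_trans qMQ).
Qed.

Lemma card_progset_le t (y u : R) k l :
  finite_set (progset S t y u k l) /\
  (#|` fset_set (progset S t y u k l)| <= W)%N.
Proof.
rewrite -[leqRHS](size_iota 0); apply: card_fset_set_le => q [[q0 Stq] _ _].
have t0 : (0 < t)%N by have [] := hS Stq; rewrite muln_gt0 => /andP[].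
suff : q \in iota 0 W by [].
by rewrite mem_iota add0n (leq_ltn_trans _ (moduli_lt Stq)) // leq_pmull.
Qed.

Lemma maxcount_le t (u : R) k l : maxcount M Q S t u k l <= W%:R.
Proof.
by apply: maxover_le => // y _; rewrite ler_nat; case: (card_progset_le t y u k l).
Qed.

Lemma dilate_itv t q : dilate S t q ->
  (0 < t)%N /\ M / t%:R < q%:R <= (M + Q) / t%:R.
Proof.
move=> [q0 Stq]; have [tq /andP[h1 h2]] := hS Stq.
have t0 : (0 < t)%N by move: tq; rewrite muln_gt0 => /andP[].
have tR : 0 < t%:R :> R by rewrite ltr0n.
by rewrite ltr_pdivrMr // ler_pdivlMr // mulrC -natrM h1 h2.
Qed.

(* The start of the window can be clamped to [M/t, (M+Q)/t] without losing
   elements of S_t. *)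
Lemma card_progset_le_maxcount t (y u : R) k l : (0 < t)%N -> 0 <= Q -> 0 <= u ->
  #|` fset_set (progset S t y u k l)|%:R <= maxcount M Q S t u k l.
Proof.
move=> t0 Q0 u0; have tR : 0 < t%:R :> R by rewrite ltr0n.
pose y' := Num.min ((M + Q) / t%:R) (Num.max (M / t%:R) y).
have MQ : M / t%:R <= (M + Q) / t%:R by rewrite ler_pM2r ?invr_gt0 // lerDl.
apply: (@le_trans _ _ #|` fset_set (progset S t y' u k l)|%:R); last first.
  apply: (@le_maxover _ _ (fun z => #|` fset_set (progset S t z u k l)|%:R) W%:R y')
    => [z _|/=].
    by rewrite ler_nat; case: (card_progset_le t z u k l).
  by rewrite /y' le_min ge_min le_max MQ !lexx.
rewrite ler_nat; apply: uniq_leq_size; first exact: fset_uniq.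
have [f1 _] := card_progset_le t y u k l.
have [f2 _] := card_progset_le t y' u k l.
move=> q; rewrite !in_fset_set // => /set_mem[Sq /andP[h1 h2] ?].
apply/mem_set; split => //.
have [_ /andP[h3 h4]] := dilate_itv Sq.
have yy : y <= Num.max (M / t%:R) y by rewrite le_max lexx orbT.
rewrite /y' gt_min gt_max h3 h1 orbT /=.
have [_|_] := leP ((M + Q) / t%:R) (Num.max (M / t%:R) y).
  exact: ler_wpDr.
by apply: le_trans h2 _; rewrite lerD2r.
Qed.

End maxima.

(** * Fractions close to a given b/r + z0 *)

Section counting.
Variable R : realType.

(** The windows are half-open and cover (c - 3u, c + 2u]; the last four alone would miss the
    endpoint c - 2u. *)
Lemma five_windows (c u x : R) : 0 < u -> `|c - x| <= 2 * u ->
  exists j : 'I_5, c + (j%:R - 3) * u < x <= c + (j%:R - 3) * u + u.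
Proof.
move=> u0; rewrite ler_norml => /andP[h1 h2].
suff [k [k5 hk]] : exists k : nat, (k < 5)%N /\
    c + (k%:R - 3) * u < x <= c + (k%:R - 3) * u + u by exists (Ordinal k5).
have [h3|h3] := leP x (c - 2 * u).
  by exists 0%N; split => //; apply/andP; split; lra.
have [h4|h4] := leP x (c - u).
  by exists 1%N; split => //; apply/andP; split; lra.
have [h5|h5] := leP x c.
  by exists 2%N; split => //; apply/andP; split; lra.
have [h6|h6] := leP x (c + u).
  by exists 3%N; split => //; apply/andP; split; lra.
by exists 4%N; split => //; apply/andP; split; lra.
Qed.

Lemma sum_nat_ge (T : eqType) (s : seq T) (F : T -> nat) (x : T) :
  x \in s -> (F x <= \sum_(y <- s) F y)%N.
Proof. by move=> xs; rewrite (big_rem x) //= leq_addr. Qed.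

Variables (N Q M : R) (S : set nat).
Hypotheses (hN : 1 <= N) (hQ : 1 <= Q) (hM : 0 <= M <= Q).
Hypothesis hS : forall q, S q -> (0 < q)%N /\ M < q%:R <= M + Q.

Section one_center.
Variables (r : nat) (b : int) (z0 : R).
Hypotheses (r0 : (0 < r)%N) (br : coprimez b r%:Z).

(* Raising |z0| to at least 1/N moves r q z0 by at most r q / N. *)
Lemma numerator_bounds (q : nat) (m : R) (z sg : R) : S q ->
  z = Num.max `|z0| N^-1 -> sg = (if 0 <= z0 then 1 else -1) ->
  `|m - r%:R * q%:R * z0| <= r%:R * q%:R / N ->
  `|m| <= 4 * r%:R * z * Q /\
  `|sg * m / (r%:R * z) - q%:R| <= 4 * Q / (z * N).
Proof.
move=> /hS[q0 /andP[_ qMQ]] zE sgE h.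
have [N0 rR qR] : [/\ 0 < N, 0 < r%:R :> R & 0 < q%:R :> R].
  by rewrite !ltr0n; split => //; exact: lt_le_trans hN.
have qQ : q%:R <= 2 * Q by have /andP[_ ?] := hM; lra.
have zN : N^-1 <= z by rewrite zE le_max lexx orbT.
have zz : `|z0| <= z by rewrite zE le_max lexx.
have zd : z - `|z0| <= N^-1.
  by rewrite zE lerBlDr ge_max lerDr lerDl normr_ge0 invr_ge0 ltW.
have z_gt0 : 0 < z by rewrite (lt_le_trans _ zN) // invr_gt0.
have rq0 : 0 < r%:R * q%:R :> R by rewrite mulr_gt0.
have rqN : r%:R * q%:R / N <= r%:R * q%:R * z by rewrite ler_pM2l.
have rqQ : r%:R * q%:R * z <= r%:R * z * (2 * Q).
  by rewrite mulrAC ler_pM2l // mulr_gt0.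
split.
  have -> : m = (m - r%:R * q%:R * z0) + r%:R * q%:R * z0 by ring.
  apply: le_trans (ler_normD _ _) _; rewrite normrM (gtr0_norm rq0).
  have : r%:R * q%:R * `|z0| <= r%:R * q%:R * z by rewrite ler_pM2l.
  lra.
have sg1 : `|sg| = 1 by rewrite sgE; case: ifP; rewrite ?normrN normr1.
have sgz : sg * z0 = `|z0|.
  by rewrite sgE; case: ger0P => _; rewrite ?mul1r ?mulN1r.
(* Each of the two terms of the numerator is at most r q / N <= 2 r Q / N in absolute value. *)
have -> : sg * m / (r%:R * z) - q%:R =
    (sg * (m - r%:R * q%:R * z0) - r%:R * q%:R * (z - `|z0|)) / (r%:R * z).
  by rewrite -sgz; field; rewrite !gt_eqF.
rewrite normrM [X in _ * X]gtr0_norm ?invr_gt0 ?mulr_gt0 //.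
rewrite ler_pdivrMr ?mulr_gt0 //.
apply: le_trans (ler_normB _ _) _; rewrite !normrM sg1 mul1r.
rewrite (ger0_norm (ltW rR)) (ger0_norm (ltW qR)).
rewrite [X in _ + _ * X]ger0_norm ?subr_ge0 //.
have h2 : r%:R * q%:R * (z - `|z0|) <= r%:R * q%:R / N by rewrite ler_pM2l.
have -> : 4 * Q / (z * N) * (r%:R * z) = 4 * Q * r%:R / N.
  by field; rewrite !gt_eqF.
have : r%:R * q%:R / N <= r%:R * (2 * Q) / N.
  by rewrite ler_pM2r ?invr_gt0 // ler_pM2l.
lra.
Qed.

(** A pair (m, q) with m nonzero is caught by t = gcd(q, r), m' = m/t and one of five windows for
    q/t; the count follows by exchanging sums. *)
Lemma size_le_divsum (E : seq (int * nat)) : uniq E ->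
  (forall e, e \in E -> [/\ S e.2,
     exists2 a, coprimez a e.2%:Z & e.1 = a * r%:Z - b * e.2%:Z
   & `|e.1%:~R - r%:R * e.2%:R * z0| <= r%:R * e.2%:R / N]) ->
  exists2 h, coprimez h r%:Z &
    (size E)%:R <= 1 + 5 * divsum N M Q S r (Num.max `|z0| N^-1) h.
Proof.
move=> uE hE; set z := Num.max _ _.
pose sg : R := if 0 <= z0 then 1 else -1.
have [[u v] /= uv] := coprimezP _ _ br.
have N0 : 0 < N by exact: lt_le_trans hN.
have Q0 : 0 < Q by exact: lt_le_trans hQ.
have rR : 0 < r%:R :> R by rewrite ltr0n.
have z_gt0 : 0 < z.
  by rewrite (@lt_le_trans _ _ N^-1) ?invr_gt0 // /z le_max lexx orbT.
(* Since u b = 1 modulo r, this is the h with h b = -1. *)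
exists (- u).
  by apply/coprimezP; exists (- b, v) => /=; rewrite mulrNN mulrC.
pose U t : R := 2 * Q / (t%:R * z * N).
pose P t (m : int) (j : 'I_5) : set nat :=
  progset S t (sg * m%:~R / (r%:R * z) + (j%:R - 3) * U t) (U t)
    (r %/ t)%N (- u * m).
pose Ms (t : nat) := [set m : int | [/\ 0 < `|m|,
  `|m|%:~R <= 6 * r%:R * z * Q / t%:R & coprimez m (r %/ t)%N%:Z]].
have finM t : finite_set (Ms t).
  apply: sub_finite_set (card_fset_set_le (@int_ball_bound _ _)).1.
  by move=> m [_ + _]; exact.
pose A t (m : int) j (e : int * nat) :=
  [&& e.1 == t%:Z * m, (t %| e.2)%N & (e.2 %/ t)%N \in P t m j].
have cover e : e \in E -> (1 <= (if e == (0 : int, r) then 1 else 0) +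
    \sum_(t <- divisors r) \sum_(m <- fset_set (Ms t)) \sum_(j < 5)
      (if A t m j e then 1 else 0))%N.
  case: e => m q eE; have [/= Sq [a aq mE] mq] := hE _ eE.
  have [q0 _] := hS Sq.
  have [m0|m0] := eqVneq m 0.
    rewrite xpair_eqE m0 (_ : q = r) ?eqxx //=.
    apply: (@eq_of_cross_mul _ _ a b) => //.
    by apply/eqP; rewrite -subr_eq0 -mE m0.
  have [m' [mm' cm' qm']] := residue_split a q0 uv.
  set t := gcdn q r in mm' cm' qm'.
  have t0 : (0 < t)%N by rewrite gcdn_gt0 q0.
  have tR : 0 < t%:R :> R by rewrite ltr0n.
  have tq : (t %| q)%N := dvdn_gcdl _ _.
  have mR : m%:~R = t%:R * m'%:~R :> R by rewrite mE mm' intrM.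
  have qR : q%:R = (q %/ t)%:R * t%:R :> R by rewrite -natrM divnK.
  have [mb wb] := numerator_bounds Sq (erefl z) (erefl sg) mq.
  have [j hj] : exists j : 'I_5, (q %/ t)%N \in P t m' j.
    have U0 : 0 < U t by rewrite divr_gt0 ?mulr_gt0.
    have [|j hj] := @five_windows (sg * m'%:~R / (r%:R * z)) (U t) (q %/ t)%:R U0.
      rewrite -(ler_pM2l tR) -{1}(gtr0_norm tR) -normrM.
      have -> : t%:R * (sg * m'%:~R / (r%:R * z) - (q %/ t)%:R) =
                sg * m%:~R / (r%:R * z) - q%:R by rewrite mR qR; ring.
      apply: le_trans wb _; rewrite /U le_eqVlt; apply/orP; left; apply/eqP.
      by field; rewrite !gt_eqF.
    exists j; apply/mem_set; split => //.
    by split; [rewrite divn_gt0 // dvdn_leq|rewrite mulnC divnK].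
  have tr : t \in divisors r by rewrite -dvdn_divisors // dvdn_gcdr.
  have mMs : m' \in fset_set (Ms t).
    rewrite in_fset_set //; apply/mem_set; split => //.
      rewrite normr_gt0; apply: contra_neq m0 => m'0.
      by rewrite mE mm' m'0 mulr0.
    rewrite ler_pdivlMr // intr_norm -(gtr0_norm tR) -normrM mulrC -mR.
    (* The constant 4 obtained for |m| fits within the 6 of [divsum]. *)
    apply: le_trans mb _; rewrite -!mulrA ler_pM2r ?ler_nat //.
    by rewrite !mulr_gt0.
  apply: leq_trans (leq_addl _ _).
  apply: leq_trans (sum_nat_ge _ tr); apply: leq_trans (sum_nat_ge _ mMs).
  apply: leq_trans (sum_nat_ge _ (mem_index_enum j)).
  by rewrite /A /= mE mm' eqxx tq hj.
have sizeE : (size E <= 1 + \sum_(t <- divisors r) \sum_(m <- fset_set (Ms t))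
    \sum_(j < 5) #|` fset_set (P t m j)|)%N.
  rewrite -sum1_size big_seq (leq_trans (leq_sum _ cover)) // -big_seq big_split /=.
  apply: leq_add.
    by rewrite -big_mkcond sum1_count (count_uniq_mem _ uE) leq_b1.
  rewrite exchange_big /= big_seq [leqRHS]big_seq; apply: leq_sum => t tr.
  have t0 : (0 < t)%N by rewrite -dvdn_divisors // in tr; exact: dvdn_gt0 tr.
  rewrite exchange_big /=; apply: leq_sum => m _.
  rewrite exchange_big /=; apply: leq_sum => j _.
  (* For fixed [t], [m], [j] the first entry of a caught pair is t m and the second is recovered
     from q/t, so the map to q/t is injective. *)
  rewrite -big_mkcond sum1_count -size_filter -(size_map (fun e => e.2 %/ t)%N).
  apply: uniq_leq_size.
    rewrite map_inj_in_uniq ?filter_uniq // => -[m1 q1] [m2 q2].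
    rewrite !mem_filter /A /= => /andP[/and3P[/eqP-> d1 _] _].
    move=> /andP[/and3P[/eqP-> d2 _] _] e.
    by rewrite -(divnK d1) -(divnK d2) e.
  move=> q' /mapP[[m1 q1]]; rewrite mem_filter /A /= => /andP[/and3P[_ _ h] _] ->.
  by rewrite in_fset_set //; exact: (card_progset_le hS _ _ _ _ _).1.
apply: (@le_trans _ _ (1 + \sum_(t <- divisors r) \sum_(m <- fset_set (Ms t))
    \sum_(j < 5) #|` fset_set (P t m j)|)%N%:R); first by rewrite ler_nat.
rewrite natrD lerD2l natr_sum /divsum mulr_sumr big_seq [leRHS]big_seq.
apply: ler_sum => t tr.
have t0 : (0 < t)%N by rewrite -dvdn_divisors // in tr; exact: dvdn_gt0 tr.
rewrite fsbig_finite; last exact: finM.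
rewrite natr_sum mulr_sumr; apply: ler_sum => m _.
rewrite natr_sum mulr_natl -[X in _ *+ X](card_ord 5) -sumr_const.
apply: ler_sum => j _; apply: card_progset_le_maxcount => //; first exact: ltW.
by rewrite ltW // divr_gt0 ?mulr_gt0 // ltr0n.
Qed.

End one_center.
End counting.

(** * Fractions of the sieve near an arbitrary point *)

Section near_fractions.
Variables (R : realType) (N Q M : R) (S : set nat).
Hypotheses (hN : 1 <= N) (hQ : 1 <= Q) (hM : 0 <= M <= Q).
Hypothesis hS : forall q, S q -> (0 < q)%N /\ M < q%:R <= M + Q.

Let N0 : 0 < N. Proof. exact: lt_le_trans hN. Qed.
Let Q0 : 0 < Q. Proof. exact: lt_le_trans hQ. Qed.

(** It keeps z = max(|z0|, 1/N) within the admissible range. *)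
Lemma mul_sqrt_le (r : nat) : r%:R <= Num.sqrt N -> r%:R * Num.sqrt N <= N.
Proof.
by move=> rN; rewrite -{2}(sqr_sqrtr (ltW N0)) expr2 ler_wpM2r ?sqrtr_ge0.
Qed.

Definition sieve_points : seq (nat * nat) :=
  [seq (q, b) | q <- fset_set S, b <- [seq b <- iota 1 q | coprime b q]].

Lemma moduli_finite : finite_set S.
Proof.
apply: sub_finite_set (finite_seq (iota 0 (Num.truncn (M + Q)).+1)) => q Sq.
suff : q \in iota 0 (Num.truncn (M + Q)).+1 by [].
by rewrite mem_iota add0n (moduli_lt hS).
Qed.

Lemma sieve_points_uniq : uniq sieve_points.
Proof.
apply: allpairs_uniq_dep; first exact: fset_uniq.
  by move=> q _; rewrite filter_uniq // iota_uniq.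
by move=> [q b] [q' b'] _ _ /= [-> ->].
Qed.

Lemma mem_sieve_points q b : (q, b) \in sieve_points ->
  [/\ S q, (0 < b <= q)%N & coprime b q].
Proof.
move=> /allpairsPdep[q' [b' [qS]]]; rewrite mem_filter mem_iota => /andP[cb bq].
move=> [-> ->]; rewrite in_fset_set // in qS; last exact: moduli_finite.
split; [exact: set_mem|lia|by []].
Qed.

Lemma sum_sieve_points (F : nat -> nat -> R) :
  \sum_(q \in S) \sum_(1 <= b < q.+1 | coprime b q) F q b =
  \sum_(p <- sieve_points) F p.1 p.2.
Proof.
rewrite fsbig_finite; last exact: moduli_finite.
rewrite big_allpairs_dep; apply: eq_bigr => q _ /=.
by rewrite big_filter /index_iota subn1.
Qed.

(** Approximate x by b/r. A near fraction c/q, shifted by an integer k, becomes a/q with a = c - k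
    q, and m = a r - b q satisfies m - r q z0 = r q (c/q - x - k). *)
Lemma count_near_le_divsum (x : R) : exists r z h,
  [/\ (0 < r)%N /\ r%:R <= Num.sqrt N, N^-1 <= z <= (r%:R * Num.sqrt N)^-1,
     coprimez h r%:Z &
     (count (fun p => `[< exists k : int,
        `|p.2%:R / p.1%:R - x - k%:~R| <= N^-1 >]) sieve_points)%:R
     <= 1 + 5 * divsum N M Q S r z h].
Proof.
have sN1 : 1 <= Num.sqrt N by have := ler_wsqrtr hN; rewrite sqrtr1.
have [r [b [r0 rN br hr]]] := dirichlet_coprime x sN1.
have rR : 0 < r%:R :> R by rewrite ltr0n.
set z0 := x - b%:~R / r%:R in hr.
pose near (p : nat * nat) (k : int) := `|p.2%:R / p.1%:R - x - k%:~R| <= N^-1.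
pose k p := xget 0 [set k | near p k].
pose m p := (p.2%:Z - k p * p.1%:Z) * r%:Z - b * p.1%:Z.
pose s := [seq p <- sieve_points | `[< exists k, near p k >]].
have sP p : p \in s -> near p (k p) /\ p \in sieve_points.
  rewrite mem_filter => /andP[/asboolP hk ps]; split => //.
  exact: (xgetPex 0 hk).
have rz : r%:Z != 0 by rewrite eqz_nat -lt0n.
have uE : uniq [seq (m p, p.1) | p <- s].
  rewrite map_inj_in_uniq ?filter_uniq ?sieve_points_uniq //.
  move=> [q1 b1] [q2 b2] /sP[_ /mem_sieve_points[_ h1 _]]
    /sP[_ /mem_sieve_points[_ h2 _]].
  rewrite /m /= => -[+ e]; rewrite -{q2}e in h2 *.
  move: (k _ : int) (k _ : int) => k2 k1 /addIr /(mulIf rz) e.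
  suff -> : b1 = b2 by [].
  (* Both numerators lie in [1, q], so their difference is a multiple of q smaller than q in
     absolute value, hence 0. *)
  have {}e : b1%:Z - b2%:Z = (k1 - k2) * q1%:Z.
    by rewrite mulrBl; lia.
  have [ek|[ek|ek]] : k1 - k2 = 0 \/ (k1 - k2 <= -1 \/ 1 <= k1 - k2) by lia.
  - by move: e; rewrite ek mul0r; lia.
  - have : (k1 - k2) * q1%:Z <= -1 * q1%:Z by rewrite ler_wpM2r.
    by rewrite -e; lia.
  - have : 1 * q1%:Z <= (k1 - k2) * q1%:Z by rewrite ler_wpM2r.
    by rewrite -e; lia.
have hE e : e \in [seq (m p, p.1) | p <- s] -> [/\ S e.2,
    exists2 a, coprimez a e.2%:Z & e.1 = a * r%:Z - b * e.2%:Z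
  & `|e.1%:~R - r%:R * e.2%:R * z0| <= r%:R * e.2%:R / N].
  move=> /mapP[[q c] /sP[hk /mem_sieve_points[Sq _ cq]] ->] /=.
  have qR : 0 < q%:R :> R by have [+ _] := hS Sq; rewrite ltr0n.
  split => //.
    exists (c%:Z - k (q, c) * q%:Z) => //.
    apply/coprimezP; have /coprimezP[[u v] /= uv] : coprimez c%:Z q%:Z by [].
    by exists (u, v + u * k (q, c)) => /=; rewrite -uv; ring.
  have -> : (m (q, c))%:~R - r%:R * q%:R * z0 =
      r%:R * q%:R * (c%:R / q%:R - x - (k (q, c))%:~R).
    by rewrite /m /z0 /= intrB !intrM intrB intrM; field; rewrite !gt_eqF.
  by rewrite normrM gtr0_norm ?mulr_gt0 // ler_pM2l ?mulr_gt0.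
have [h hr' hs] := size_le_divsum hN hQ hM hS r0 br uE hE.
exists r, (Num.max `|z0| N^-1), h; split => //.
  rewrite le_max lexx orbT ge_max hr lef_pV2 ?posrE ?mulr_gt0 ?mul_sqrt_le //.
  exact: lt_le_trans sN1.
by rewrite size_map size_filter in hs.
Qed.

Lemma maxcount_ge0 t (u : R) k l : (0 < t)%N -> 0 <= u ->
  0 <= maxcount M Q S t u k l.
Proof.
move=> t0 u0.
by apply: le_trans (card_progset_le_maxcount hS 0 k l t0 (ltW Q0) u0).
Qed.

Lemma divsum_ge0 r z h : (0 < r)%N -> N^-1 <= z -> 0 <= divsum N M Q S r z h.
Proof.
move=> r0 zN; have z0 : 0 < z by rewrite (lt_le_trans _ zN) // invr_gt0.
rewrite /divsum big_seq; apply: sumr_ge0 => t tr.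
have t0 : (0 < t)%N by rewrite -dvdn_divisors // in tr; exact: dvdn_gt0 tr.
apply: sumr_ge0 => m _; apply: maxcount_ge0 => //.
by rewrite ltW // divr_gt0 ?mulr_gt0 // ltr0n.
Qed.

(** A crude bound, uniform in r, z and h, to make the nested suprema finite: there are at most r <=
    N divisors, |m| <= 6Q as r z <= 1, and each count is at most floor(M + Q) + 1. *)
Lemma divsum_le r z h : (0 < r)%N -> r%:R <= Num.sqrt N ->
  N^-1 <= z <= (r%:R * Num.sqrt N)^-1 ->
  divsum N M Q S r z h <=
    N * ((2 * Num.truncn (6 * Q)).+1%:R * (Num.truncn (M + Q)).+1%:R).
Proof.
move=> r0 rN /andP[zN zr]; set B := _ * _%:R.
have z0 : 0 < z by rewrite (lt_le_trans _ zN) // invr_gt0.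
have rR : 0 < r%:R :> R by rewrite ltr0n.
have sN1 : 1 <= Num.sqrt N by have := ler_wsqrtr hN; rewrite sqrtr1.
have sN0 : 0 < Num.sqrt N by exact: lt_le_trans sN1.
have rN' : r%:R <= N.
  by apply: le_trans (mul_sqrt_le rN); rewrite ler_peMr // ltW.
have rz1 : r%:R * z <= 1.
  rewrite -(ler_pM2r sN0) mul1r mulrAC -ler_pdivlMl ?mulr_gt0 //.
  by rewrite (le_trans zr) // ler_peMr // invr_ge0 mulr_ge0 // ltW.
have B0 : 0 <= B by rewrite mulr_ge0.
apply: (@le_trans _ _ (\sum_(t <- divisors r) B)); last first.
  rewrite big_const_seq iter_addr_0 count_predT -mulr_natl ler_wpM2r //.
  apply: le_trans rN'; rewrite ler_nat -[leqRHS](size_iota 1).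
  apply: uniq_leq_size; first exact: divisors_uniq.
  move=> t tr; rewrite -dvdn_divisors // in tr.
  by rewrite mem_iota add1n ltnS (dvdn_gt0 r0 tr) dvdn_leq.
rewrite /divsum big_seq [leRHS]big_seq; apply: ler_sum => t tr.
have t0 : (0 < t)%N by rewrite -dvdn_divisors // in tr; exact: dvdn_gt0 tr.
have t1 : 1 <= t%:R :> R by rewrite ler1n.
set Ms := (X in \sum_(m \in X) _).
have [finM cardM] : finite_set Ms /\
    (#|` fset_set Ms| <= (2 * Num.truncn (6 * Q)).+1)%N.
  have sub : Ms `<=` [set m : int | `|m|%:~R <= 6 * Q].
    move=> m [_ hm _]; apply: (le_trans hm).
    rewrite ler_pdivrMr; last exact: lt_le_trans t1.
    have h1 : 6 * r%:R * z * Q <= 6 * Q.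
      have -> : 6 * r%:R * z * Q = r%:R * z * (6 * Q) by ring.
      by rewrite ler_piMl // mulr_ge0 // ltW.
    by apply: (le_trans h1); rewrite ler_peMr // mulr_ge0 // ltW.
  have := card_fset_set_le (subset_trans sub (@int_ball_bound _ (6 * Q))).
  by rewrite size_map size_iota.
rewrite fsbig_finite //.
apply: (@le_trans _ _ (\sum_(m <- fset_set Ms) (Num.truncn (M + Q)).+1%:R)).
  by apply: ler_sum => m _; exact: maxcount_le.
rewrite /B big_const_seq iter_addr_0 count_predT -[X in X <= _]mulr_natl ler_wpM2r //.
by rewrite ler_nat.
Qed.

End near_fractions.

(** * Deduction of the sieve inequality *)

Theorem theorem1 (R : realType) :
  exists c1 : R, 0 < c1 /\
  forall (N Q M : R) (a : nat -> R[i]) (S : set nat),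
    1 <= N -> 1 <= Q -> 0 <= M <= Q ->
    (forall q : nat, S q -> (0 < q)%N /\ M < q%:R <= M + Q) ->
    \sum_(q \in S) \sum_(1 <= b < q.+1 | coprime b q)
        abs2 (trigsum N a (b%:R / q%:R))
      <= c1 * N * energy N a * (1 +
          maxover [set r : nat | (0 < r)%N /\ r%:R <= Num.sqrt N] (fun r =>
          maxover [set z : R | N^-1 <= z <= (r%:R * Num.sqrt N)^-1] (fun z =>
          maxover [set h : int | coprimez h r%:Z] (fun h =>
            divsum N M Q S r z h)))).
Proof.
(* 80 = 16 * 5: the large sieve is applied with K = 1 + 5G <= 5(1 + G). *)
exists 80; split => // N Q M a S hN hQ hM hS.
rewrite (sum_sieve_points hS (fun q b => abs2 (trigsum N a (b%:R / q%:R)))).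
set G := maxover _ _.
pose B : R := N * ((2 * Num.truncn (6 * Q)).+1%:R * (Num.truncn (M + Q)).+1%:R).
have B0 : 0 <= B by rewrite mulr_ge0 ?mulr_ge0 // (le_trans _ hN).
have le_G r z h : (0 < r)%N -> r%:R <= Num.sqrt N ->
    N^-1 <= z <= (r%:R * Num.sqrt N)^-1 -> coprimez h r%:Z ->
    divsum N M Q S r z h <= G.
  move=> r0 rN zr hr.
  have le_h r' z' h' : (0 < r')%N /\ r'%:R <= Num.sqrt N ->
      N^-1 <= z' <= (r'%:R * Num.sqrt N)^-1 -> divsum N M Q S r' z' h' <= B.
    by move=> [? ?] ?; exact: divsum_le.
  have le_z r' z' : (0 < r')%N /\ r'%:R <= Num.sqrt N ->
      N^-1 <= z' <= (r'%:R * Num.sqrt N)^-1 ->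
      maxover [set h : int | coprimez h r'%:Z] (divsum N M Q S r' z') <= B.
    by move=> ? ?; apply: maxover_le => // h' _; exact: le_h.
  have le_r r' : (0 < r')%N /\ r'%:R <= Num.sqrt N ->
      maxover [set z : R | N^-1 <= z <= (r'%:R * Num.sqrt N)^-1] (fun z =>
        maxover [set h : int | coprimez h r'%:Z] (divsum N M Q S r' z)) <= B.
    by move=> ?; apply: maxover_le => // z' ?; exact: le_z.
  apply: le_trans (le_maxover (f := fun r => maxover _ _) le_r (conj r0 rN)).
  apply: le_trans (le_maxover (f := fun z => maxover _ _)
    (fun z' => le_z r z' (conj r0 rN)) zr).
  exact: (le_maxover (fun h' _ => le_h r z h' (conj r0 rN) zr) hr).
(* The approximation of the point 0 supplies an admissible triple (r, z, h), at which [divsum] is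
   nonnegative. *)
have G0 : 0 <= G.
  have [r [z [h [[r0 rN] zr hr _]]]] := count_near_le_divsum hN hQ hM hS 0.
  apply: le_trans (le_G r z h r0 rN zr hr).
  by apply: divsum_ge0 => //; case/andP: zr.
have E0 : 0 <= energy N a by apply: sumr_ge0 => m _; exact: abs2_ge0.
have K0 : 0 < 1 + 5 * G by lra.
apply: le_trans (large_sieve a hN K0 _) _.
  move=> x; have [r [z [h [[r0 rN] zr hr hc]]]] :=
    count_near_le_divsum hN hQ hM hS x.
  apply: le_trans hc _; have := le_G r z h r0 rN zr hr; lra.
have NE : 0 <= N * energy N a by rewrite mulr_ge0 // (le_trans _ hN).
nra.
Qed.
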